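(* Let $H$ be a real Hilbert space, let $C \subset H$ be a nonempty closed convex set, let $a_1,\dots,a_m \in H$ be points that are not collinear, and let $w_1,\dots,w_m > 0$. Then the problem $$\min\Big\{ f(x) = \sum_{i=1}^m w_i\|x-a_i\| \;:\; x \in C\Big\}$$ has a solution, and this solution is unique; that is, there is exactly one $\bar x \in C$ with $f(\bar x) \le f(x)$ for all $x \in C$.
   Context: Points $a_1,\dots,a_m$ are collinear if some straight line of $H$ contains all of them; the points $a_i$ may or may not belong to $C$. *)

(* Defs.v *)
From HB Require Import structures.
From mathcomp Require Import all_boot all_order all_algebra sesquilinear.
From mathcomp Require Import all_classical all_reals all_analysis.

Set Implicit Arguments.
Unset Strict Implicit.
Unset Printing Implicit Defensive.

Import Order.TTheory GRing.Theory Num.Theory.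

Local Open Scope classical_set_scope.
Local Open Scope ring_scope.

(* The direction vector must be nonzero, so a single point is not a line and
   the trivial module contains no line at all. *)
Definition straight_line (R : realType) (H : lmodType R) (L : set H) : Prop :=
  exists p d : H, d != 0 /\ L = [set p + t *: d | t in [set: R]].

Definition collinear (R : realType) (H : lmodType R) (m : nat)
    (a : 'I_m -> H) : Prop :=
  exists L : set H, straight_line L /\ forall i, L (a i).

Definition weighted_distance_sum (R : realType) (H : normedModType R) (m : nat)
    (w : 'I_m -> R) (a : 'I_m -> H) (x : H) : R :=
  \sum_(i < m) w i * `|x - a i|.

(* H, as a complete normed space, is a Hilbert space when its norm is the one
   induced by a real inner product, i.e. a positive definite symmetric bilinear
   form; with [theta := idfun] the library's sesquilinear forms are bilinear
   and its Hermitian forms symmetric. *)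
Definition hilbert_space (R : realType) (H : completeNormedModType R) : Prop :=
  exists inner : {dot H for idfun},
    forall x : H, `|x| = Num.sqrt (inner x x).

(* Main.v *)
(** Existence: the sublevel sets of the objective inside [C] are closed, convex,
    bounded and nested, so by the parallelogram identity they have a common
    point.  Uniqueness: the midpoint of two distinct minimizers [x], [y] can be
    no better than them, so each triangle inequality
    [|x + y - 2 a_i| <= |x - a_i| + |y - a_i|] is an equality, and this puts
    every [a_i] on the line through [x] and [y]. *)
Require Import Defs.
From mathcomp Require Import all_boot all_order all_algebra.
From mathcomp Require Import all_classical all_reals all_analysis.
From mathcomp Require Import sesquilinear ring lra.

Set Implicit Arguments.
Unset Strict Implicit.
Unset Printing Implicit Defensive.

Import Order.TTheory GRing.Theory Num.Theory.
Import numFieldNormedType.Exports.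

Local Open Scope classical_set_scope.
Local Open Scope ring_scope.

Lemma hilbert_normD_sqr (R : realType) (H : completeNormedModType R)
    (inner : {dot H for idfun})
    (norm_inner : forall x : H, `|x| = Num.sqrt (inner x x)) (x y : H) :
  `|x + y| ^+ 2 = `|x| ^+ 2 + `|y| ^+ 2 + 2 * inner x y.
Proof.
have inner_ge0 z : 0 <= inner z z.
  have [->|z0] := eqVneq z 0; first by rewrite linear0l.
  exact/ltW/neq0_dnorm_gt0.
rewrite !norm_inner !sqr_sqrtr// linearDl /= !linearDr /=.
have -> : inner y x = inner x y by rewrite hermC /= expr0 mul1r.
lra.
Qed.

Lemma hilbert_parallelogram (R : realType) (H : completeNormedModType R)
    (hH : hilbert_space H) (x y : H) :
  `|x + y| ^+ 2 + `|x - y| ^+ 2 = 2 * (`|x| ^+ 2 + `|y| ^+ 2).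
Proof.
have [inner norm_inner] := hH.
rewrite !(hilbert_normD_sqr norm_inner) normrN linearNr /=; lra.
Qed.

(** Squaring the hypothesis gives equality in Cauchy-Schwarz, [inner x y = |x| * |y|]. With this
    value the expansion of the squared norm of [|y| *: x - |x| *: y] cancels to zero. *)
Lemma hilbert_normD_eq (R : realType) (H : completeNormedModType R)
    (hH : hilbert_space H) (x y : H) :
  `|x + y| = `|x| + `|y| -> `|y| *: x = `|x| *: y.
Proof.
have [inner norm_inner] := hH => xyD.
have innerE : inner x y = `|x| * `|y|.
  have := hilbert_normD_sqr norm_inner x y; rewrite xyD; nra.
apply/eqP; rewrite -subr_eq0 -normr_eq0 -sqrf_eq0; apply/eqP.
rewrite (hilbert_normD_sqr norm_inner) normrN !normrZ !normr_id linearNr /=.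
rewrite linearZl_LR /= linearZr_LR /= innerE; ring.
Qed.

Lemma convex_set_midpoint (R : realType) (H : normedModType R) (C : set H) :
  convex_set (C : set (convex_lmodType H)) ->
  forall x y, C x -> C y -> C (2^-1 *: (x + y)).
Proof.
move=> convC x y Cx Cy.
have half_ge0 : 0 <= (2^-1 : R) by lra.
have half_le1 : (2^-1 : R) <= 1 by lra.
have := set_mem (convC x y (Itv01 half_ge0 half_le1) (mem_set Cx) (mem_set Cy)).
have -> // : conv (Itv01 half_ge0 half_le1) (x : convex_lmodType H)
    (y : convex_lmodType H) = 2^-1 *: (x + y).
rewrite /conv /= scalerDr; congr (_ *: _ + _ *: _).
by rewrite /unstable.onem; lra.
Qed.

(* The almost norm-minimal points of the sets form a Cauchy sequence; this
   takes the place of weak compactness of bounded closed convex sets. *)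
Lemma hilbert_nested_nonempty (R : realType) (H : completeNormedModType R)
    (hH : hilbert_space H) (S : nat -> set H) :
  (forall n, closed (S n)) -> (forall n, S n !=set0) ->
  (forall n m, (n <= m)%N -> S m `<=` S n) ->
  (forall n x y, S n x -> S n y -> S n (2^-1 *: (x + y))) ->
  (exists M, forall x, S 0%N x -> `|x| <= M) ->
  exists x, forall n, S n x.
Proof.
move=> Scl S0 Sdec Smid [M SM].
(* [d n] is the squared distance from the origin to [S n]. It increases with [n] and stays below
   [M ^+ 2], so its increments eventually become small. *)
pose E n := [set `|x| ^+ 2 | x in S n].
pose d n := inf (E n).
have E_lb n : has_lbound (E n).
  by exists 0 => _ [x _ <-]; exact: sqr_ge0.
have E_n0 n : E n !=set0.
  by have [x Sx] := S0 n; exists (`|x| ^+ 2); exists x.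
have d_le n x : S n x -> d n <= `|x| ^+ 2.
  by move=> Sx; apply: ge_inf => //; exists x.
have d_mono n m : (n <= m)%N -> d n <= d m.
  move=> nm; apply: lb_le_inf => // _ [x Sx <-].
  by apply: d_le; exact: Sdec Sx.
have d_ub n : d n <= M ^+ 2.
  have [x Sx] := S0 n; apply: le_trans (d_le _ _ Sx) _.
  have := SM _ (Sdec _ _ (leq0n n) _ Sx); have := normr_ge0 x; nra.
have /choice[u uP] : forall n, exists x, S n x /\ `|x| ^+ 2 < d n + n.+1%:R^-1.
  move=> n; have /inf_adherent : (0 : R) < n.+1%:R^-1 by rewrite invr_gt0 ltr0n.
  by move=> /(_ (E n) (conj (E_n0 n) (E_lb n)))[_ [x Sx <-] xd]; exists x.
have uS n m : (n <= m)%N -> S n (u m).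
  by move=> nm; apply: Sdec nm _ _; have [] := uP m.
(* Both points lie in [S n], hence so does their midpoint, whose squared norm is at least [d n]. The
   parallelogram identity turns this lower bound into an upper bound on the distance. *)
have u_dist n m : (n <= m)%N ->
    `|u n - u m| ^+ 2 <= 2 * n.+1%:R^-1 + 2 * m.+1%:R^-1 + 2 * (d m - d n).
  move=> nm.
  have := d_le _ _ (Smid _ _ _ (uS _ _ (leqnn n)) (uS _ _ nm)).
  have -> : `|2^-1 *: (u n + u m)| = 2^-1 * `|u n + u m|.
    by rewrite normrZ ger0_norm// invr_ge0 ler0n.
  have := hilbert_parallelogram hH (u n) (u m).
  have [_] := uP n; have [_] := uP m.
  by move: (n.+1%:R^-1) (m.+1%:R^-1) => e1 e2; lra.
pose D := [set d n | n in [set: nat]].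
have D_sup : has_sup D.
  by split; [exists (d 0%N); exists 0%N | exists (M ^+ 2) => _ [n _ <-]].
have u_cauchy : cauchy (u @ \oo).
  apply: cauchy_exP => e e0.
  (* Each of the three terms in [u_dist] is twice a quantity below this bound, so their sum is below
     6/8 of [e ^+ 2]. *)
  have e20 : 0 < e ^+ 2 / 8 by rewrite divr_gt0// exprn_gt0.
  have [_ [N1 _ <-] N1P] := sup_adherent e20 D_sup.
  have [N2 _ N2P] := near_infty_natSinv_lt (PosNum e20).
  pose N := maxn N1 N2; exists (u N); exists N => // m /= Nm.
  rewrite -ball_normE /=.
  have d_m : d m <= sup D by apply: ub_le_sup; [case: D_sup | exists m].
  have d_N : d N1 <= d N by apply: d_mono; rewrite leq_maxl.
  have /= N_lt := N2P N (leq_maxr _ _).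
  have /= m_lt := N2P m (leq_trans (leq_maxr _ _) Nm).
  rewrite -(ltr_pXn2r (n := 2)) ?nnegrE ?(ltW e0)//.
  move: N_lt m_lt (u_dist _ _ Nm).
  by move: (N.+1%:R^-1) (m.+1%:R^-1) => e1 e2; lra.
have /cauchy_cvgP/cvg_ex[l ul] := u_cauchy.
exists l => n; apply: (closed_cvg (S n)) ul => //.
by exists n => // m /= nm; exact: uS.
Qed.

(** The sets where [f] exceeds its infimum on [C] by at most [1/(n+1)] are nested. Continuity makes
    them closed, midpoint convexity keeps midpoints inside, and coercivity bounds the first one. A
    common point attains the infimum. *)
Lemma hilbert_midconvex_min (R : realType) (H : completeNormedModType R)
    (hH : hilbert_space H) (C : set H) (f : H -> R) :
  C !=set0 -> closed C -> (forall x y, C x -> C y -> C (2^-1 *: (x + y))) ->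
  continuous f -> (forall x, 0 <= f x) ->
  (forall x y, f (2^-1 *: (x + y)) <= 2^-1 * (f x + f y)) ->
  (forall t, exists M, forall x, f x <= t -> `|x| <= M) ->
  exists x, C x /\ forall y, C y -> f x <= f y.
Proof.
move=> C0 Ccl Cmid fcont f_ge0 fmid fcoer.
pose E := f @` C.
have E_lb : has_lbound E by exists 0 => _ [x _ <-].
have E_n0 : E !=set0 by have [x Cx] := C0; exists (f x); exists x.
pose S n := C `&` [set x | f x <= inf E + n.+1%:R^-1].
have [|n|n m nm x [Cx /= fx]|n x y [Cx /= fx] [Cy /= fy]||x xS] :=
    hilbert_nested_nonempty hH (S := S).
- move=> n; apply: closedI => //.
  apply: (closed_comp (f := f) (D := [set y | y <= inf E + n.+1%:R^-1])).
    by move=> x _; exact: fcont.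
  exact: closed_le.
- have /inf_adherent : (0 : R) < n.+1%:R^-1 by rewrite invr_gt0 ltr0n.
  by move=> /(_ E (conj E_n0 E_lb))[_ [x Cx <-] /ltW xE]; exists x.
- split=> //=; apply: le_trans fx _.
  by rewrite lerD2l lef_pV2 ?posrE ?ltr0n// ler_nat.
- split; first exact: Cmid.
  rewrite /=; apply: le_trans (fmid x y) _.
  by move: fx fy; move: (n.+1%:R^-1) => e; lra.
- have [M MP] := fcoer (inf E + 1%:R^-1).
  by exists M => x [_ /= fx]; exact: MP.
exists x; split; first by have [] := xS 0%N.
move=> y Cy; have fy : inf E <= f y by apply: ge_inf => //; exists y.
apply: le_trans fy; apply/ler_addgt0Pr => e e0.
have [N _ NP] := near_infty_natSinv_lt (PosNum e0).
have [_ /= fx] := xS N.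
move: (NP N (leqnn N)) fx => /=.
by move: (N.+1%:R^-1) => r; lra.
Qed.

Lemma weighted_distance_sum_continuous (R : realType) (H : normedModType R)
    (m : nat) (w : 'I_m -> R) (a : 'I_m -> H) :
  continuous (weighted_distance_sum w a).
Proof.
move=> x; rewrite /weighted_distance_sum.
apply: cvg_big => [|i _]; first exact: add_continuous.
apply: cvgMr; apply: cvg_norm.
by apply: cvgB; [exact: cvg_id | exact: cvg_cst].
Qed.

Lemma norm_midpoint_le (R : realType) (H : normedModType R) (x y p : H) :
  `|2^-1 *: (x + y) - p| <= 2^-1 * (`|x - p| + `|y - p|).
Proof.
have -> : 2^-1 *: (x + y) - p = 2^-1 *: ((x - p) + (y - p)).
  rewrite addrACA -opprD scalerBr -mulr2n -[p *+ 2]scaler_nat scalerA.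
  by rewrite mulVf ?scale1r// pnatr_eq0.
rewrite normrZ ger0_norm ?invr_ge0 ?ler0n//.
by rewrite ler_pM2l ?invr_gt0 ?ltr0n// ler_normD.
Qed.

Lemma weighted_distance_sum_midpoint_le (R : realType) (H : normedModType R)
    (m : nat) (w : 'I_m -> R) (a : 'I_m -> H) (x y : H) :
  (forall i, 0 < w i) ->
  weighted_distance_sum w a (2^-1 *: (x + y)) <=
  2^-1 * (weighted_distance_sum w a x + weighted_distance_sum w a y).
Proof.
move=> w0; rewrite /weighted_distance_sum -big_split mulr_sumr /=.
apply: ler_sum => i _; rewrite -mulrDr mulrCA ler_pM2l//.
exact: norm_midpoint_le.
Qed.

Lemma hilbert_midpoint_dist_eq (R : realType) (H : completeNormedModType R)
    (hH : hilbert_space H) (x y p : H) : x != y ->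
  `|2^-1 *: (x + y) - p| = 2^-1 * (`|x - p| + `|y - p|) ->
  exists t : R, x + t *: (x - y) = p.
Proof.
move=> xy xyp.
have /(hilbert_normD_eq hH) uv : `|(x - p) + (y - p)| = `|x - p| + `|y - p|.
  have two0 : (2 : R) != 0 by rewrite pnatr_eq0.
  move/(congr1 (fun r : R => 2 * r)): xyp; rewrite mulVKf// => <-.
  rewrite -[X in X * `|_|]ger0_norm ?ler0n// -normrZ scalerBr scalerA.
  by rewrite divff// scale1r addrACA -opprD -mulr2n -[p *+ 2]scaler_nat.
(* If [x] and [y] were equidistant from [p], the relation [uv] would force [x = y]: by cancelling
   the common distance if it is nonzero, and because both points equal [p] otherwise. *)
have [uvE|uvN] := eqVneq `|x - p| `|y - p|.
  have [u0|u0] := eqVneq `|x - p| 0.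
    move: (u0); rewrite uvE => /eqP; rewrite normr_eq0 subr_eq0 => /eqP yp.
    move/eqP: u0; rewrite normr_eq0 subr_eq0 => /eqP xp.
    by rewrite xp yp eqxx in xy.
  move: uv; rewrite -uvE => /(scalerI u0)/addIr xyE.
  by rewrite xyE eqxx in xy.
have k0 : `|y - p| - `|x - p| != 0 by rewrite subr_eq0 eq_sym.
(* Substituting [y - p = (x - p) - (x - y)] into [uv] and solving for [p] yields this parameter. *)
exists (`|x - p| / (`|y - p| - `|x - p|)).
apply: (scalerI k0); rewrite scalerDr scalerA mulrCA divff// mulr1.
apply/eqP; rewrite addrC -subr_eq0 -addrA -scalerBr.
have -> : x - y = (x - p) - (y - p) by rewrite opprB addrA subrK.
by rewrite scalerBl uv -scalerBr -scalerDr addrA subrK subrr scaler0.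
Qed.

Theorem mainTheorem1 (R : realType) (H : completeNormedModType R)
    (hH : hilbert_space H)
    (C : set H) (hC0 : C !=set0) (hCclosed : closed C)
    (hCconvex : convex_set (C : set (convex_lmodType H)))
    (m : nat) (a : 'I_m -> H) (ha : ~ collinear a)
    (w : 'I_m -> R) (hw : forall i, 0 < w i) :
  exists! xbar : H,
    C xbar /\
    forall x : H, C x ->
      weighted_distance_sum w a xbar <= weighted_distance_sum w a x.
Proof.
(* The zero space contains no line, so non-collinearity holds there automatically; its only point is
   the minimizer. *)
have [[d d0]|Htriv] := pselect (exists d : H, d != 0); last first.
  have H0 (x : H) : x = 0.
    by apply/eqP/negP => /negP x0; apply: Htriv; exists x.
  have [c Cc] := hC0; exists c; split=> [|x _]; last by rewrite (H0 x) (H0 c).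
  by split=> // x _; rewrite (H0 x) (H0 c).
have Cmid := convex_set_midpoint hCconvex.
(* An empty family would lie on any line, for instance the one spanned by [d]. *)
have [i0 _] : exists i0 : 'I_m, True.
  apply: contrapT => noI; apply: ha.
  exists [set 0 + t *: d | t in [set: R]]; split; first by exists 0, d.
  by move=> i; case: noI; exists i.
have term_ge0 x i : 0 <= w i * `|x - a i| by rewrite mulr_ge0// ltW.
have [x [Cx xmin]] : exists x, C x /\ forall y, C y ->
    weighted_distance_sum w a x <= weighted_distance_sum w a y.
  apply: hilbert_midconvex_min => //.
  - exact: weighted_distance_sum_continuous.
  - by move=> x; exact: sumr_ge0.
  - by move=> x y; exact: weighted_distance_sum_midpoint_le.
  (* Coercivity comes from a single term: [w i0 * (|x| - |a i0|)] is at most the whole sum. *)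
  move=> t; exists (t / w i0 + `|a i0|) => x xt.
  rewrite -lerBlDr; apply: le_trans (lerB_dist _ _) _.
  rewrite ler_pdivlMr// mulrC; apply: le_trans xt.
  by rewrite /weighted_distance_sum (bigD1 i0)//= lerDl sumr_ge0.
exists x; split=> // y [Cy ymin].
apply/eqP/negP => /negP xy; apply: ha.
exists [set x + t *: (x - y) | t in [set: R]]; split.
  by exists x, (x - y); rewrite subr_eq0.
pose z := 2^-1 *: (x + y).
(* The weighted slack in the midpoint inequality at [a i]. The slacks are nonnegative and add up to
   the mean of the objective at [x] and [y] minus its value at [z], which minimality makes
   nonpositive; hence each one vanishes. *)
pose gap i := w i * (2^-1 * (`|x - a i| + `|y - a i|) - `|z - a i|).
have gap_ge0 i : 0 <= gap i.
  by rewrite mulr_ge0 ?(ltW (hw i))// subr_ge0 norm_midpoint_le.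
have gap_sum : \sum_i gap i = 0.
  apply/eqP; rewrite eq_le sumr_ge0// andbT.
  have -> : \sum_i gap i = 2^-1 * (weighted_distance_sum w a x +
      weighted_distance_sum w a y) - weighted_distance_sum w a z.
    rewrite /weighted_distance_sum -big_split mulr_sumr -sumrB /=.
    by apply: eq_bigr => i _; rewrite /gap; ring.
  have := xmin _ (Cmid _ _ Cx Cy); have := ymin _ Cx; rewrite -/z; lra.
move=> i; have : gap i = 0.
  exact: (psumr_eq0P (fun j _ => gap_ge0 j) gap_sum).
move/eqP; rewrite mulf_eq0 gt_eqF//= subr_eq0 => /eqP/esym.
by move=> /(hilbert_midpoint_dist_eq hH xy)[t <-]; exists t.
Qed.
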